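(* Assume the standing assumptions on $F$. Consider SVRC under sampling without replacement, fix an iteration $k$ with $k\bmod m\ne0$, and condition on all randomness up to the computation of $x_k$ (so $x_k$, $\tilde x$, $s_k$ are fixed). Let $\zeta\in(0,1)$. If $$|\xi_g(k)|\ge\Big(\frac1N+\frac{\beta^2\max\{\|s_k\|^4,\epsilon_1^4\}}{64L_1^2\|x_k-\tilde x\|^2\log(2(d+1)/\zeta)}\Big)^{-1},$$ then with probability at least $1-\zeta$, $\|g_k-\nabla F(x_k)\|\le\beta\max\{\|s_k\|^2,\epsilon_1^2\}$. If $$|\xi_H(k)|\ge\Big(\frac1N+\frac{\alpha^2\max\{\|s_k\|^2,\epsilon_1^2\}}{64L_2^2\|x_k-\tilde x\|^2\log(4d/\zeta)}\Big)^{-1},$$ then with probability at least $1-\zeta$, $\|H_k-\nabla^2F(x_k)\|\le\alpha\max\{\|s_k\|,\epsilon_1\}$.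
   Context: Objective: $F(x)=\frac1N\sum_{i=1}^N f_i(x)$ on $\mathbb{R}^d$, each $f_i$ twice differentiable. Standing assumptions: $F^*\triangleq\inf_x F(x)>-\infty$; for every $i$, $f_i$, $\nabla f_i$ and $\nabla^2 f_i$ are Lipschitz with constants $L_0$, $L_1$, $L_2$ respectively (Hessian differences measured in spectral norm). All matrix norms are spectral norms. SVRC iteration with parameters $x_0\in\mathbb{R}^d$, $\epsilon_1>0$, integer $m\ge1$, $M>0$: for $k=0,1,2,\dots$: if $k\bmod m=0$, set $g_k=\nabla F(x_k)$, $H_k=\nabla^2F(x_k)$ and set the reference quantities $\tilde x=x_k$, $\tilde g=g_k$, $\tilde H=H_k$; otherwise draw index collections $\xi_g(k),\xi_H(k)\subseteq\{1,\dots,N\}$ at random and set $g_k=\frac1{|\xi_g(k)|}\sum_{i\in\xi_g(k)}(\nabla f_i(x_k)-\nabla f_i(\tilde x))+\tilde g$, $H_k=\frac1{|\xi_H(k)|}\sum_{i\in\xi_H(k)}(\nabla^2 f_i(x_k)-\nabla^2 f_i(\tilde x))+\tilde H$. Then $s_{k+1}$ is a global minimizer of $s\mapsto g_k^\top s+\frac12 s^\top H_k s+\frac M6\|s\|^3$, $x_{k+1}=x_k+s_{k+1}$, and the algorithm stops and returns $x_{k+1}$ if $\max\{\|s_{k+1}\|,\|s_k\|\}\le\epsilon_1$. By convention $s_0$ is a vector with $\|s_0\|=\epsilon_1$. Sampling without replacement: $\xi_g(k)$ and $\xi_H(k)$ are drawn uniformly at random among all subsets of $\{1,\dots,N\}$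 of the prescribed cardinalities (cardinalities less than $N$). Here $\alpha,\beta>0$ are fixed constants. *)

(* Defs.v *)
From HB Require Import structures.
From mathcomp Require Import all_boot.
From Stdlib Require Import Reals ClassicalEpsilon.

Set Implicit Arguments.
Unset Strict Implicit.
Unset Printing Implicit Defensive.

Local Open Scope R_scope.

Definition vec (d : nat) := 'I_d -> R.
Definition mat (d : nat) := 'I_d -> 'I_d -> R.

Definition vadd d (u v : vec d) : vec d := fun j => u j + v j.
Definition vsub d (u v : vec d) : vec d := fun j => u j - v j.
Definition msub d (A B : mat d) : mat d := fun i j => A i j - B i j.
Definition dot d (u v : vec d) : R := \big[Rplus/0%R]_(j < d) (u j * v j).
Definition matvec d (A : mat d) (v : vec d) : vec d :=
  fun i => \big[Rplus/0%R]_(j < d) (A i j * v j).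

Definition vnorm d (v : vec d) : R := sqrt (\big[Rplus/0%R]_(j < d) (v j * v j)).

Definition opnorm d (A : mat d) : R :=
  epsilon (inhabits 0%R)
    (fun c => is_lub (fun r => exists v : vec d, vnorm v <= 1 /\ r = vnorm (matvec A v)) c).

Definition has_gradient d (f : vec d -> R) (g : vec d) (x : vec d) : Prop :=
  forall eps, 0 < eps -> exists delta, 0 < delta /\
    forall h : vec d, vnorm h < delta ->
      Rabs (f (vadd x h) - f x - dot g h) <= eps * vnorm h.

Definition has_jacobian d (G : vec d -> vec d) (J : mat d) (x : vec d) : Prop :=
  forall eps, 0 < eps -> exists delta, 0 < delta /\
    forall h : vec d, vnorm h < delta ->
      vnorm (vsub (vsub (G (vadd x h)) (G x)) (matvec J h)) <= eps * vnorm h.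

Definition Favg d N (f : 'I_N -> vec d -> R) (x : vec d) : R :=
  / INR N * \big[Rplus/0%R]_(i < N) f i x.
Definition gradF d N (G : 'I_N -> vec d -> vec d) (x : vec d) : vec d :=
  fun j => / INR N * \big[Rplus/0%R]_(i < N) G i x j.
Definition hessF d N (H : 'I_N -> vec d -> mat d) (x : vec d) : mat d :=
  fun a b => / INR N * \big[Rplus/0%R]_(i < N) H i x a b.

(* SVRC variance-reduced estimators for sample S, current point xk,
   reference point xt (with reference quantities gradF xt, hessF xt) *)
Definition g_est d N (G : 'I_N -> vec d -> vec d) (S : {set 'I_N}) (xk xt : vec d) : vec d :=
  fun j => / INR #|S| * \big[Rplus/0%R]_(i in S) (G i xk j - G i xt j) + gradF G xt j.
Definition H_est d N (H : 'I_N -> vec d -> mat d) (S : {set 'I_N}) (xk xt : vec d) : mat d :=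
  fun a b => / INR #|S| * \big[Rplus/0%R]_(i in S) (H i xk a b - H i xt a b) + hessF H xt a b.

Definition Rleb (a b : R) : bool := if Rle_dec a b then true else false.

(* Main.v *)
(* The sample mean is compared with the population mean through the even trace
   moments of a matrix martingale. Adding the elements of the sample one at a
   time and dividing the centred sum by the number of elements not yet drawn
   gives a martingale whose increments have operator norm
   at most 2 c / (N - k - 1), and the squares of these bounds add up to a
   multiple of 1/n - 1/N.

   For symmetric A and a centred family of symmetric X_i of norm at most r, the
   second derivative of t |-> tr (A + t X_i)^(2p) is controlled by
   2p (2p - 1) r^2 tr (A + t X_i)^(2p - 2): by Cauchy-Schwarz the Frobenius norms
   |A^a X A^(m - a)|^2 are midpoint-convex in a, so each tr (A^k X A^l X) is at
   most |A^m X|^2. Hence the normalised moments tr M^(2p) / (2p)! of the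
   martingale are at most (V/2)^p / p! times the dimension, as if M were
   Gaussian, and the Chernoff bound for cosh gives the tail 2 D exp(-t^2 / 2V).
   Rectangular matrices are
   handled through their symmetric dilation, so that gradients (1 x d) have
   D = d + 1 and Hessians D = 2d, whether or not the latter are symmetric. *)

From Stdlib Require Import Reals ClassicalEpsilon.
From mathcomp Require Import all_boot all_order all_algebra.
From mathcomp Require Import polyrcf Rstruct ring lra.
Require Import Defs.

Set Implicit Arguments.
Unset Strict Implicit.
Unset Printing Implicit Defensive.

Import Order.TTheory GRing.Theory Num.Theory.
Local Open Scope ring_scope.

(** * Squared Frobenius norms and squared operator-norm bounds *)

Definition frob (R : pzRingType) m n (A : 'M[R]_(m, n)) : R := \tr (A *m A^T).

(** Here [c] plays the role of the squared operator norm, which keeps square roots out; vectors are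
    rows. *)
Definition opbound (R : rcfType) m n (A : 'M[R]_(m, n)) (c : R) : Prop :=
  forall v : 'rV[R]_m, frob (v *m A) <= c * frob v.

Section Frobenius.
Variable R : rcfType.

Lemma frobE m n (A : 'M[R]_(m, n)) : frob A = \sum_i \sum_j A i j ^+ 2.
Proof.
apply: eq_bigr => i _; rewrite !mxE; apply: eq_bigr => j _.
by rewrite !mxE expr2.
Qed.

Lemma frob_ge0 m n (A : 'M[R]_(m, n)) : 0 <= frob A.
Proof. by rewrite frobE; do 2!(apply: sumr_ge0 => ? _); apply: sqr_ge0. Qed.

Lemma frob_eq0 m n (A : 'M[R]_(m, n)) : frob A = 0 -> A = 0.
Proof.
rewrite frobE => /eqP; rewrite psumr_eq0; last first.
  by move=> i _; apply: sumr_ge0 => j _; apply: sqr_ge0.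
move=> /allP A0; apply/matrixP => i j; rewrite mxE.
have /implyP/(_ isT) := A0 i (mem_index_enum _).
rewrite psumr_eq0; last by move=> k _; apply: sqr_ge0.
by move=> /allP /(_ j (mem_index_enum _)) /implyP/(_ isT); rewrite sqrf_eq0 => /eqP.
Qed.

Lemma frob0 m n : frob (0 : 'M[R]_(m, n)) = 0.
Proof. by rewrite /frob mul0mx mxtrace0. Qed.

Lemma frobZ m n a (A : 'M[R]_(m, n)) : frob (a *: A) = a ^+ 2 * frob A.
Proof. by rewrite /frob linearZ -scalemxAl -scalemxAr scalerA mxtraceZ expr2. Qed.

Lemma frobT m n (A : 'M[R]_(m, n)) : frob A^T = frob A.
Proof. by rewrite /frob trmxK mxtrace_mulC. Qed.

Lemma mxtrace_mulmxTC m n (A B : 'M[R]_(m, n)) :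
  \tr (A *m B^T) = \tr (B *m A^T).
Proof. by rewrite -mxtrace_tr trmx_mul trmxK. Qed.

Lemma frobD m n (A B : 'M[R]_(m, n)) :
  frob (A + B) = frob A + 2 * \tr (A *m B^T) + frob B.
Proof.
rewrite /frob linearD mulmxDr !mulmxDl !mxtraceD (mxtrace_mulmxTC B A).
ring.
Qed.

Lemma frobB_le m n (A B : 'M[R]_(m, n)) : frob (A - B) <= 2 * (frob A + frob B).
Proof.
have h := frob_ge0 (A + B).
have : frob (A - B) + frob (A + B) = 2 * (frob A + frob B).
  rewrite !frobD linearN mulmxN linearN /= -(scaleN1r B) frobZ; ring.
by move=> <-; rewrite lerDl.
Qed.

Lemma mxtrace_mulT_le m n (A B : 'M[R]_(m, n)) :
  2 * \tr (A *m B^T) <= frob A + frob B.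
Proof.
have := frob_ge0 (A - B); rewrite frobD linearN mulmxN linearN /=.
rewrite -(scaleN1r B) frobZ; lra.
Qed.

Lemma mxtrace_mulT_CauchySchwarz m n (A B : 'M[R]_(m, n)) :
  \tr (A *m B^T) ^+ 2 <= frob A * frob B.
Proof.
have [B0|Bn0] := eqVneq (frob B) 0.
  by rewrite (frob_eq0 B0) trmx0 mulmx0 mxtrace0 frob0 mulr0 expr0n.
have Bp : 0 < frob B by rewrite lt_neqAle eq_sym Bn0 frob_ge0.
have := frob_ge0 (frob B *: A - \tr (A *m B^T) *: B).
rewrite frobD -scaleNr !frobZ linearZ -scalemxAl -scalemxAr !mxtraceZ.
set x := \tr _; set b := frob B; set a := frob A => h.
have : 0 <= b * (a * b - x ^+ 2) by nra.
by rewrite pmulr_rge0 // subr_ge0.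
Qed.

Lemma frob_row m n (A : 'M[R]_(m, n)) : frob A = \sum_i frob (row i A).
Proof.
rewrite frobE; apply: eq_bigr => i _; rewrite frobE big_ord1.
by apply: eq_bigr => j _; rewrite mxE.
Qed.

Lemma frob_mul_opbound m n p (A : 'M[R]_(m, n)) (X : 'M[R]_(n, p)) c :
  opbound X c -> frob (A *m X) <= c * frob A.
Proof.
move=> hX; rewrite !(frob_row) mulr_sumr; apply: ler_sum => i _.
by rewrite row_mul.
Qed.

(** For [y = v X^T], [|y|^2] is the inner product of [y X] and [v]. Cauchy-Schwarz and the bound on
    [y X] give [|y|^4 <= c |y|^2 |v|^2], and a factor [|y|^2] cancels. *)
Lemma opbound_tr m n (X : 'M[R]_(m, n)) c : 0 <= c -> opbound X c -> opbound X^T c.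
Proof.
move=> c0 hX v; set y := v *m X^T.
have [->|yn0] := eqVneq (frob y) 0; first by rewrite mulr_ge0 // frob_ge0.
have yp : 0 < frob y by rewrite lt_neqAle eq_sym yn0 frob_ge0.
have E : frob y = \tr ((y *m X) *m v^T).
  by rewrite /frob {2}/y trmx_mul trmxK mulmxA.
have := mxtrace_mulT_CauchySchwarz (y *m X) v; rewrite -E => h.
have h2 : frob y ^+ 2 <= c * frob y * frob v.
  by apply: le_trans h _; apply: ler_wpM2r; [exact: frob_ge0|exact: hX].
rewrite -(ler_pM2l yp); move: h2; rewrite expr2 => h2; apply: le_trans h2 _.
by rewrite mulrCA mulrA.
Qed.

Lemma frob_mulmx_le m n p (A : 'M[R]_(m, n)) (B : 'M[R]_(n, p)) :
  frob (A *m B) <= frob A * frob B.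
Proof.
rewrite frob_row (frob_row A) mulr_suml; apply: ler_sum => i _.
rewrite row_mul; set v := row i A.
rewrite -(frobT B) (frob_row B^T) frobE big_ord1 mulr_sumr.
apply: ler_sum => j _.
rewrite -[row j _]trmxK; set w := (row j _)^T.
have -> : (v *m B) 0 j = \tr (v *m w).
  by rewrite /mxtrace big_ord1 !mxE; apply: eq_bigr => k _; rewrite !mxE.
by have := mxtrace_mulT_CauchySchwarz v w^T; rewrite trmxK.
Qed.

End Frobenius.

(** * Traces of powers of symmetric matrices *)

Section SymmetricTrace.
Variables (R : rcfType) (n : nat).
Implicit Types (A X : 'M[R]_n).

Lemma trmxX A k : (A ^+ k)^T = A^T ^+ k.
Proof.
by elim: k => [|k IH]; rewrite ?expr0 ?trmx1 // exprS exprSr -!mulmxE trmx_mul IH.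
Qed.

Lemma trmxX_sym A k : A^T = A -> (A ^+ k)^T = A ^+ k.
Proof. by move=> sA; rewrite trmxX sA. Qed.

Lemma frobX_sym A k : A^T = A -> frob (A ^+ k) = \tr (A ^+ k.*2).
Proof. by move=> sA; rewrite /frob trmxX_sym // mulmxE -exprD addnn. Qed.

Lemma mxtraceX_sym_ge0 A k : A^T = A -> 0 <= \tr (A ^+ k.*2).
Proof. by move=> sA; rewrite -frobX_sym // frob_ge0. Qed.

(** By cyclicity the inner product of two sandwiches depends only on the sums of their left and of
    their right exponents. *)
Lemma mxtrace_sandwich A X a b a' b' : A^T = A -> X^T = X ->
  \tr ((A ^+ a *m X *m A ^+ b) *m (A ^+ a' *m X *m A ^+ b')^T) =
  \tr (A ^+ (a' + a) *m X *m A ^+ (b + b') *m X).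
Proof.
move=> sA sX; rewrite !trmx_mul sX !trmxX_sym //.
rewrite !mulmxE !exprD !mulrA -[LHS]mxtrace_mulC mulmxE.
by rewrite !mulrA.
Qed.

(** Discrete maximum principle: once the sequence exceeds [c 0], convexity keeps it from decreasing
    up to [m], so it could not return to [c m = c 0]. *)
Lemma midpoint_convex_le (c : nat -> R) m :
  (forall a, (a.+1 < m)%N -> 2 * c a.+1 <= c a + c a.+2) -> c m = c 0 ->
  forall a, (a <= m)%N -> c a <= c 0.
Proof.
move=> cvx cm.
have grow a : (a < m)%N -> c a <= c 0 \/ c a <= c a.+1.
  elim: a => [|a IH] am; first by left.
  have [|h] := leP (c a.+1) (c 0); [by left|right].
  have := cvx a am; case: (IH (ltnW am)); lra.
move=> a am; case: leP => // ha.
have : forall b, (a + b <= m)%N -> c 0 < c (a + b)%N.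
  elim=> [|b IH]; first by rewrite addn0.
  rewrite addnS => hb; have h := IH (ltnW hb).
  case: (grow _ hb); lra.
by move=> /(_ (m - a)%N); rewrite subnKC // cm ltxx => /(_ (leqnn _)).
Qed.

Lemma frob_sandwich_le A X m a : A^T = A -> X^T = X -> (a <= m)%N ->
  frob (A ^+ a *m X *m A ^+ (m - a)) <= frob (A ^+ m *m X).
Proof.
move=> sA sX am.
pose c a := frob (A ^+ a *m X *m A ^+ (m - a)).
have c0 : c 0 = frob (A ^+ m *m X).
  by rewrite /c subn0 expr0 mul1mx -frobT trmx_mul sX trmxX_sym.
rewrite -c0; apply: (@midpoint_convex_le c m) => //; last first.
  by rewrite c0 /c subnn expr0 mulmx1.
move=> {am}b bm.
(* The value at [b.+1] is the inner product of the sandwiches at [b] and [b.+2], so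
   [2 <U, V> <= |U|^2 + |V|^2] is the convexity. *)
have -> : c b.+1 = \tr ((A ^+ b *m X *m A ^+ (m - b)) *m
                        (A ^+ b.+2 *m X *m A ^+ (m - b.+2))^T).
  rewrite /c /frob !mxtrace_sandwich //; congr (\tr (A ^+ _ *m X *m A ^+ _ *m X)).
    by rewrite !addSn addnS.
  by rewrite -(subnSK bm) -(subnSK (ltnW bm)) -(subnSK bm) !addSn addnS.
exact: mxtrace_mulT_le.
Qed.

(* The exponents [k] and [l] need not be even: an odd split is the inner
   product of the two neighbouring even ones. *)
Lemma mxtrace_XmulX_le A X m k l : A^T = A -> X^T = X -> (k + l)%N = m.*2 ->
  \tr (A ^+ k *m X *m A ^+ l *m X) <= frob (A ^+ m *m X).
Proof.
move=> sA sX klm.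
have [a Hk] : exists a, k = (odd k + a.*2)%N by exists k./2; rewrite odd_double_half.
have [b Hl] : exists b, l = (odd l + b.*2)%N by exists l./2; rewrite odd_double_half.
have Ho : odd k = odd l.
  by have := congr1 odd klm; rewrite oddD odd_double; case: odd; case: odd.
case: (odd k) (odd l) Hk Hl Ho => -[] // Hk Hl _; last first.
  have Em : m = (a + b)%N.
    by apply: double_inj; rewrite -klm Hk Hl doubleD !add0n.
  have := @frob_sandwich_le A X m a sA sX; rewrite Em leq_addr addKn => /(_ isT).
  by rewrite {1}/frob mxtrace_sandwich // !addnn Hk Hl !add0n.
have Em : m = (a + b).+1.
  by apply: double_inj; rewrite -klm Hk Hl doubleS doubleD !add1n addSn addnS.
have h1 := @frob_sandwich_le A X m a sA sX; have h2 := @frob_sandwich_le A X m a.+1 sA sX.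
move: h1 h2; rewrite Em ltnS leq_addr (leqW (leq_addr _ _)) => /(_ isT) h1 /(_ isT) h2.
rewrite subSS addKn in h2; rewrite -addnS addKn addnS in h1.
have := mxtrace_mulT_le (A ^+ a *m X *m A ^+ b.+1) (A ^+ a.+1 *m X *m A ^+ b).
rewrite mxtrace_sandwich // addSn addnn addSn addnn Hk Hl !add1n; lra.
Qed.

Lemma mxtrace_XmulX_opbound A X r m k l : A^T = A -> X^T = X -> opbound X r ->
  (k + l)%N = m.*2 -> \tr (A ^+ k *m X *m A ^+ l *m X) <= r * \tr (A ^+ m.*2).
Proof.
move=> sA sX hX klm; apply: le_trans (mxtrace_XmulX_le sA sX klm) _.
by rewrite -frobX_sym //; apply: frob_mul_opbound.
Qed.

(** This is how a trace moment detects a large operator norm. The numbers [mu j = |v A^j|^2] are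
    log-convex by Cauchy-Schwarz and [mu 0 <= 1], so [mu 1 ^ (p + 1) <= mu (p + 1)], which is at
    most the squared Frobenius norm of [A^(p + 1)]. *)
Lemma frob_mulmx_expr_le A (v : 'rV[R]_n) p : A^T = A -> frob v <= 1 ->
  frob (v *m A) ^+ p.+1 <= \tr (A ^+ p.+1.*2).
Proof.
move=> sA hv; rewrite -frobX_sym //.
pose mu j := frob (v *m A ^+ j).
have mu_ge0 j : 0 <= mu j by exact: frob_ge0.
have cs j : mu j.+1 ^+ 2 <= mu j * mu j.+2.
  have -> : mu j.+1 = \tr ((v *m A ^+ j) *m (v *m A ^+ j.+2)^T).
    have E (V W : 'M[R]_n) : \tr ((v *m V) *m (v *m W)^T) = \tr (v *m (V *m W^T) *m v^T).
      by rewrite trmx_mul !mulmxA.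
    by rewrite /mu /frob !E !trmxX_sym // !mulmxE -!exprD addSn !addnS.
  exact: mxtrace_mulT_CauchySchwarz.
have step j : mu j * mu 1 <= mu j.+1.
  elim: j => [|j IH]; first by rewrite ler_piMl // /mu expr0 mulmx1.
  have [z|nz] := eqVneq (mu j) 0.
    have /eqP : mu j.+1 ^+ 2 = 0.
      by apply/eqP; rewrite eq_le sqr_ge0 andbT; have := cs j; rewrite z mul0r.
    by rewrite sqrf_eq0 => /eqP ->; rewrite mul0r.
  have pz : 0 < mu j by rewrite lt_neqAle eq_sym nz mu_ge0.
  rewrite -(ler_pM2l pz); apply: le_trans (cs j).
  by rewrite mulrCA expr2 ler_wpM2l // mulrC.
have pw : mu 1 ^+ p.+1 <= mu p.+1.
  elim: p => [|p IH]; first by rewrite expr1.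
  by rewrite exprSr; apply: le_trans (step p.+1); rewrite ler_wpM2r.
move: pw; rewrite {1}/mu expr1 => /le_trans; apply.
apply: le_trans (frob_mulmx_le _ _) _.
by rewrite ler_piMl // frob_ge0.
Qed.

End SymmetricTrace.

(** * Formal derivatives of traces along the line A + t X *)

Section MatrixPencil.
Variables (R : rcfType) (n : nat).
Implicit Types (A X : 'M[R]_n) (M : 'M[{poly R}]_n).

(** The indeterminate stands for [t]: differentiation is formal, and [horner_eval t] recovers
    [A + t X]. *)
Definition pencil A X : 'M[{poly R}]_n := map_mx polyC A + 'X *: map_mx polyC X.

Lemma map_mxX (S T : pzSemiRingType) (f : {rmorphism S -> T}) (A : 'M[S]_n) k :
  map_mx f (A ^+ k) = map_mx f A ^+ k.
Proof.
by elim: k => [|k IH]; rewrite ?expr0 ?map_mx1 // !exprS -!mulmxE map_mxM IH.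
Qed.

Lemma map_mx_deriv_mul m1 m2 m3 (M : 'M[{poly R}]_(m1, m2)) (M' : 'M[{poly R}]_(m2, m3)) :
  map_mx deriv (M *m M') = map_mx deriv M *m M' + M *m map_mx deriv M'.
Proof.
apply/matrixP => i j; rewrite !mxE raddf_sum -big_split /=; apply: eq_bigr => k _.
by rewrite derivM !mxE.
Qed.

Lemma deriv_mxtrace M : (\tr M)^`() = \tr (map_mx deriv M).
Proof. by rewrite /mxtrace raddf_sum; apply: eq_bigr => i _; rewrite mxE. Qed.

Lemma map_mx_deriv_pencil A X : map_mx deriv (pencil A X) = map_mx polyC X.
Proof.
apply/matrixP => i j; rewrite !mxE derivD derivM derivX !derivC.
by rewrite mul1r mulr0 addr0 add0r.
Qed.

Lemma map_mx_deriv_pencilX A X k :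
  map_mx deriv (pencil A X ^+ k) =
  \sum_(i < k) pencil A X ^+ i *m map_mx polyC X *m pencil A X ^+ (k.-1 - i).
Proof.
elim: k => [|k IH].
  by rewrite expr0 big_ord0; apply/matrixP => i j; rewrite !mxE -polyC_natr derivC.
rewrite exprS -mulmxE map_mx_deriv_mul map_mx_deriv_pencil IH.
rewrite big_ord_recl /= expr0 mul1mx subn0; congr (_ + _).
rewrite mulmx_sumr; apply: eq_bigr => i _.
by rewrite !mulmxA mulmxE -exprS /bump /= add1n subnS -!subn1 -!subnDA addnC.
Qed.

(** Although [A] and [X] may not commute, cyclicity makes all terms of the product rule equal under
    the trace. This fails for the second derivative, which stays a sum of sandwiches. *)
Lemma deriv_mxtrace_pencilX A X k :
  (\tr (pencil A X ^+ k.+1))^`() =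
  k.+1%:R *: \tr (pencil A X ^+ k *m map_mx polyC X).
Proof.
rewrite deriv_mxtrace map_mx_deriv_pencilX raddf_sum /=.
rewrite (eq_bigr (fun=> \tr (pencil A X ^+ k *m map_mx polyC X))).
  by rewrite sumr_const card_ord scaler_nat.
move=> i _; rewrite mxtrace_mulC mulmxA mulmxE -exprD subnK //.
by rewrite -ltnS.
Qed.

Lemma deriv_mxtrace_pencilX_mul A X k :
  (\tr (pencil A X ^+ k *m map_mx polyC X))^`() =
  \sum_(i < k) \tr (pencil A X ^+ i *m map_mx polyC X *m
                    pencil A X ^+ (k.-1 - i) *m map_mx polyC X).
Proof.
rewrite deriv_mxtrace map_mx_deriv_mul map_mx_deriv_pencilX.
have -> : map_mx deriv (map_mx polyC X) = 0.
  by apply/matrixP => i j; rewrite !mxE derivC.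
by rewrite mulmx0 addr0 mulmx_suml raddf_sum.
Qed.

Lemma map_mx_horner_polyC t A : map_mx (horner_eval t) (map_mx polyC A) = A.
Proof. by apply/matrixP => i j; rewrite !mxE /horner_eval hornerC. Qed.

Lemma map_mx_horner_pencil t A X : map_mx (horner_eval t) (pencil A X) = A + t *: X.
Proof.
by apply/matrixP => i j; rewrite !mxE /horner_eval hornerD hornerM hornerX !hornerC.
Qed.

Lemma horner_mxtrace t M : (\tr M).[t] = \tr (map_mx (horner_eval t) M).
Proof. by rewrite trace_map_mx. Qed.

Lemma horner_mxtrace_pencilX t A X k : (\tr (pencil A X ^+ k)).[t] = \tr ((A + t *: X) ^+ k).
Proof. by rewrite horner_mxtrace map_mxX map_mx_horner_pencil. Qed.

Lemma horner_mxtrace_pencilX_mul t A X k :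
  (\tr (pencil A X ^+ k *m map_mx polyC X)).[t] = \tr ((A + t *: X) ^+ k *m X).
Proof.
by rewrite horner_mxtrace map_mxM map_mxX map_mx_horner_pencil map_mx_horner_polyC.
Qed.

Lemma horner_mxtrace_pencilX_sandwich t A X k l :
  (\tr (pencil A X ^+ k *m map_mx polyC X *m pencil A X ^+ l *m map_mx polyC X)).[t] =
  \tr ((A + t *: X) ^+ k *m X *m (A + t *: X) ^+ l *m X).
Proof.
by rewrite horner_mxtrace !map_mxM !map_mxX map_mx_horner_pencil map_mx_horner_polyC.
Qed.

End MatrixPencil.

(** * One martingale step for the even trace moments *)

Section MomentStep.
Variable R : rcfType.

(** Mean value theorem on [[0, x]]. Two applications reduce a comparison of polynomials to their
    second derivatives. *)
Lemma horner_ge0_deriv (p : {poly R}) : 0 <= p.[0] ->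
  (forall x, 0 <= x -> 0 <= p^`().[x]) -> forall x, 0 <= x -> 0 <= p.[x].
Proof.
move=> p0 dp x; rewrite le_eqVlt => /predU1P[<- //|x0].
have [c cx E] := poly_mvt p x0.
rewrite -(subrK p.[0] p.[x]) E subr0 addr_ge0 // mulr_ge0 ?(ltW x0) // dp //.
by move: cx; rewrite in_itv /= => /andP[/ltW].
Qed.

(** The coefficient of [s^(2p)] in [tr cosh (s A)]. *)
Definition cosh_moment n p (A : 'M[R]_n) : R := \tr (A ^+ p.*2) / (p.*2)`!%:R.

Lemma cosh_moment_ge0 n p (A : 'M[R]_n) : A^T = A -> 0 <= cosh_moment p A.
Proof. by move=> sA; rewrite divr_ge0 ?ler0n // mxtraceX_sym_ge0. Qed.

Lemma deriv2_even_monomial j (a : R) :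
  (a *: 'X^(j.+1.*2))^`()^`() = (a * (j.*2.+2 * j.*2.+1)%:R) *: 'X^(j.*2).
Proof.
by rewrite doubleS derivZ derivXn derivZ derivMn derivXn /= -mulrnA -scaler_nat scalerA mulnC.
Qed.

(* A second-order Taylor comparison: both sides, as polynomials in a scaling [t]
   of the increments [X i], agree to first order at [t = 0]. *)
Lemma cosh_moment_step (I : finType) (J : {pred I}) n (A : 'M[R]_n)
    (X : I -> 'M[R]_n) (r : R) p :
  0 <= r -> A^T = A -> {in J, forall i, (X i)^T = X i} ->
  {in J, forall i, opbound (X i) r} -> \sum_(i in J) X i = 0 ->
  \sum_(i in J) cosh_moment p (A + X i) <=
  #|J|%:R * \sum_(j < p.+1) (r / 2) ^+ j / j`!%:R * cosh_moment (p - j) A.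
Proof.
move=> r0 sA sX oX X0.
pose tau k : {poly R} := \sum_(i in J) (k.*2)`!%:R^-1 *: \tr (pencil A (X i) ^+ k.*2).
pose cf k j := #|J|%:R * ((r / 2) ^+ j / j`!%:R * cosh_moment (k - j) A).
pose q k : {poly R} := \sum_(j < k.+1) cf k j *: 'X^(j.*2).
have tauE t k : (tau k).[t] = \sum_(i in J) cosh_moment k (A + t *: X i).
  rewrite horner_sum; apply: eq_bigr => i _.
  by rewrite hornerZ horner_mxtrace_pencilX mulrC.
suff main k t : 0 <= t -> (tau k).[t] <= (q k).[t].
  have := main p 1 ler01; rewrite tauE.
  rewrite (eq_bigr (fun i => cosh_moment p (A + X i))); last by move=> i _; rewrite scale1r.
  move=> /le_trans; apply; rewrite horner_sum mulr_sumr; apply: ler_sum => j _.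
  by rewrite hornerZ hornerXn expr1n mulr1.
(* Differentiating twice lowers the order of the moment by one: [(tau k.+1)'' <= r * tau k] and
   [r * q k <= (q k.+1)''], with the induction hypothesis in between. *)
elim: k t => [|k IH] t t0.
  rewrite tauE (eq_bigr (fun=> n%:R)); last first.
    by move=> i _; rewrite /cosh_moment double0 expr0 mxtrace1 fact0 divr1.
  rewrite sumr_const /q big_ord1 hornerZ hornerXn double0 expr0 mulr1.
  rewrite /cf expr0 fact0 /cosh_moment subn0 double0 expr0 fact0 mxtrace1 !divr1 mul1r. by rewrite mulr_natl.
rewrite -subr_ge0 -hornerN -hornerD; move: t t0.
have dtau : (tau k.+1)^`() = \sum_(i in J) (k.*2.+1)`!%:R^-1 *:
     \tr (pencil A (X i) ^+ k.*2.+1 *m map_mx polyC (X i)).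
  rewrite raddf_sum; apply: eq_bigr => i _ /=.
  rewrite derivZ doubleS deriv_mxtrace_pencilX scalerA; congr (_ *: _).
  by rewrite [in LHS]factS natrM invfM mulrAC mulVf ?mul1r // pnatr_eq0.
apply: horner_ge0_deriv.
  rewrite hornerD hornerN tauE subr_ge0 (eq_bigr (fun=> cosh_moment k.+1 A)); last first.
    by move=> i _; rewrite scale0r addr0.
  rewrite sumr_const horner_sum big_ord_recl /= [X in _ + X]big1 => [|j _].
    rewrite hornerZ double0 expr0 hornerC mulr1 /cf expr0 fact0 subn0 divr1 mul1r addr0.
    by rewrite mulr_natl.
  by rewrite hornerZ hornerXn expr0n mulr0.
rewrite derivB; apply: horner_ge0_deriv.
  (* At [t = 0] the derivative of [tau] is linear in the [X i], which sum to 0, and [q] has even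
     powers only. *)
  rewrite hornerD hornerN dtau horner_sum.
  rewrite (eq_bigr (fun i => \tr ((k.*2.+1)`!%:R^-1 *: (A ^+ k.*2.+1 *m X i)))); last first.
    move=> i _; rewrite hornerZ horner_mxtrace_pencilX_mul.
    by rewrite scale0r addr0 linearZ.
  rewrite -raddf_sum -scaler_sumr -mulmx_sumr X0 mulmx0 scaler0  /= mxtrace0 subr0.
  rewrite raddf_sum horner_sum big1 // => -[j jk] _ /=.
  rewrite derivZ hornerZ derivXn hornerMn hornerXn.
  by case: j jk => [|j] jk; rewrite ?double0 ?mulr0n ?mulr0 // doubleS expr0n mul0rn mulr0.
move=> t t0; rewrite derivB hornerD hornerN subr_ge0.
apply: (@le_trans _ _ (r * (tau k).[t])); last first.
  apply: (@le_trans _ _ (r * (q k).[t])); first by rewrite ler_wpM2l // IH.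
  have -> : (q k.+1)^`()^`() = \sum_(j < k.+1)
      (cf k.+1 j.+1 * (j.*2.+2 * j.*2.+1)%:R) *: 'X^(j.*2).
    rewrite /q big_ord_recl derivD derivD double0 expr0 derivZ derivC scaler0.
    rewrite derivC add0r !raddf_sum /=; apply: eq_bigr => j _.
    by rewrite /bump add1n deriv2_even_monomial.
  rewrite !horner_sum mulr_sumr; apply: ler_sum => -[j jk] _ /=.
  rewrite !hornerZ hornerXn mulrA.
  apply: ler_wpM2r; first by rewrite exprn_ge0.
  rewrite /cf subSS factS !natrM invfM exprS.
  set a := (r / 2) ^+ j; set b := cosh_moment _ _; set f := (_`!)%:R^-1.
  have a0 : 0 <= a by rewrite exprn_ge0 // divr_ge0.
  have b0 : 0 <= b by exact: cosh_moment_ge0.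
  have f0 : 0 <= f by rewrite invr_ge0 ler0n.
  (* The factor [2 (j + 1)] cancels the new [1 / 2] and the new factor of the factorial; the
     remaining [2 j + 1 >= 1] is dropped. *)
  have -> : j.*2.+2%:R = 2 * j.+1%:R :> R by rewrite -doubleS -mul2n natrM.
  have -> : #|J|%:R * (r / 2 * a * (j.+1%:R^-1 * f) * b) * (2 * j.+1%:R * j.*2.+1%:R) =
            r * (#|J|%:R * (a * f * b)) * j.*2.+1%:R.
    have : j.+1%:R != 0 :> R by rewrite pnatr_eq0.
    by move: (j.+1%:R : R) => u u0; field.
  apply: ler_peMr; last by rewrite ler1n. by repeat (apply: mulr_ge0 => //). 
rewrite dtau raddf_sum horner_sum tauE mulr_sumr; apply: ler_sum => i iJ /=.
rewrite derivZ hornerZ deriv_mxtrace_pencilX_mul horner_sum.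
rewrite mulrC /cosh_moment mulrA factS natrM invfM mulrA.
apply: ler_wpM2r; first by rewrite invr_ge0 ler0n.
(* The second derivative has [k.*2.+1] sandwiches, each at most [r] times the trace of the power
   [k.*2]; their number is absorbed by the factorial. *)
rewrite ler_pdivrMr ?ltr0n // -[X in _ <= _ * X%:R](card_ord k.*2.+1) mulr_natr -sumr_const.
apply: ler_sum => -[j jk] _ /=.
rewrite horner_mxtrace_pencilX_sandwich; apply: mxtrace_XmulX_opbound.
- by rewrite linearD linearZ /= sA sX.
- exact: sX.
- exact: oX.
- by rewrite subnKC.
Qed.

End MomentStep.

(** * Bounds for differences, means and symmetric dilations *)

Section OperatorBounds.
Variable R : rcfType.

Lemma frob_sum_le (I : finType) (J : {pred I}) m n (B : I -> 'M[R]_(m, n)) :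
  frob (\sum_(j in J) B j) <= #|J|%:R * \sum_(j in J) frob (B j).
Proof.
rewrite -(ler_pM2l (ltr0Sn R 1)) {1}/frob raddf_sum /= mulmx_suml raddf_sum /=.
have -> : 2 * (#|J|%:R * \sum_(j in J) frob (B j)) =
    \sum_(j in J) \sum_(k in J) (frob (B j) + frob (B k)).
  rewrite [RHS](eq_bigr (fun j => frob (B j) *+ #|J| + \sum_(k in J) frob (B k))).
    rewrite big_split /= sumr_const sumrMnl -mulr_natl; ring.
  by move=> j _; rewrite big_split /= sumr_const.
rewrite mulr_sumr; apply: ler_sum => j _; rewrite mulmx_sumr raddf_sum mulr_sumr.
by apply: ler_sum => k _; apply: mxtrace_mulT_le.
Qed.

Lemma opboundZ m n (X : 'M[R]_(m, n)) c a : opbound X c -> opbound (a *: X) (a ^+ 2 * c).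
Proof.
by move=> hX v; rewrite -scalemxAr frobZ -mulrA ler_wpM2l ?sqr_ge0.
Qed.

(** The constants are squared norms, so a doubled norm appears as the factor 4. *)
Lemma opboundB m n (X Y : 'M[R]_(m, n)) c :
  opbound X c -> opbound Y c -> opbound (X - Y) (4 * c).
Proof.
move=> hX hY v; rewrite mulmxBr; apply: le_trans (frobB_le _ _) _.
have := hX v; have := hY v; lra.
Qed.

Lemma opbound_mean (I : finType) (J : {pred I}) m n (X : I -> 'M[R]_(m, n)) c :
  (0 < #|J|)%N -> {in J, forall j, opbound (X j) c} ->
  opbound (#|J|%:R^-1 *: \sum_(j in J) X j) c.
Proof.
move=> J0 hX v; rewrite -scalemxAr frobZ mulmx_sumr.
have Jp : 0 < #|J|%:R :> R by rewrite ltr0n.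
rewrite exprVn mulrC ler_pdivrMr ?exprn_gt0 //.
apply: le_trans (frob_sum_le _ _) _; rewrite mulrC expr2 mulrA ler_wpM2r ?(ltW Jp) //.
rewrite mulr_natr -sumr_const; apply: ler_sum => j Jj; exact: hX.
Qed.

Definition dilation m n (X : 'M[R]_(m, n)) : 'M[R]_(m + n) := block_mx 0 X X^T 0.

Lemma dilation_sym m n (X : 'M[R]_(m, n)) : (dilation X)^T = dilation X.
Proof. by rewrite /dilation tr_block_mx !trmx0 trmxK. Qed.

Lemma dilationD m n (X Y : 'M[R]_(m, n)) : dilation (X + Y) = dilation X + dilation Y.
Proof. by rewrite /dilation add_block_mx !addr0 linearD. Qed.

Lemma dilation0 m n : dilation (0 : 'M[R]_(m, n)) = 0.
Proof. by rewrite /dilation trmx0 block_mx0. Qed.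

Lemma dilation_sum (I : finType) (J : {pred I}) m n (X : I -> 'M[R]_(m, n)) :
  dilation (\sum_(j in J) X j) = \sum_(j in J) dilation (X j).
Proof. exact: (big_morph _ (@dilationD m n) (@dilation0 m n)). Qed.

Lemma dilationZ m n a (X : 'M[R]_(m, n)) : dilation (a *: X) = a *: dilation X.
Proof. by rewrite /dilation scale_block_mx !scaler0 linearZ. Qed.

Lemma frob_row_mx m n (u : 'rV[R]_m) (w : 'rV[R]_n) : frob (row_mx u w) = frob u + frob w.
Proof. by rewrite /frob tr_row_mx mul_row_col mxtraceD. Qed.

(** The two off-diagonal blocks act on separate halves of the vector, so squared norms add. *)
Lemma opbound_dilation m n (X : 'M[R]_(m, n)) c : 0 <= c ->
  opbound X c -> opbound (dilation X) c.
Proof.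
move=> c0 hX v; rewrite -(hsubmxK v) /dilation mul_row_block !mulmx0 add0r addr0.
by rewrite !frob_row_mx mulrDr addrC lerD // opbound_tr.
Qed.

Lemma frob_mul_dilation m n (X : 'M[R]_(m, n)) (u : 'rV[R]_m) :
  frob (row_mx u 0 *m dilation X) = frob (u *m X).
Proof.
by rewrite /dilation mul_row_block !mulmx0 mul0mx !addr0 frob_row_mx frob0 add0r.
Qed.

End OperatorBounds.

(** * Sampling without replacement as a matrix martingale *)

Section Sampling.
Variables (R : rcfType) (I : finType).
Local Notation N := #|I|.
Local Notation "''Sub_' k" := [set S : {set I} | #|S| == k] (at level 8, k at level 2).

(** Double counting: a set of size [k + 1] is [i |: S] once for each of its elements [i]. This takes
    the place of conditional expectation along the growing sample. *)
Lemma sum_subsets_succ (phi : {set I} -> R) k :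
  \sum_(S in 'Sub_k) \sum_(i in ~: S) phi (i |: S) =
  k.+1%:R * \sum_(S in 'Sub_(k.+1)) phi S.
Proof.
have -> : k.+1%:R * \sum_(S in 'Sub_(k.+1)) phi S =
          \sum_(S in 'Sub_(k.+1)) \sum_(i in S) phi S.
  rewrite mulr_sumr; apply: eq_bigr => S; rewrite inE => /eqP Sk.
  by rewrite sumr_const Sk mulr_natl.
rewrite (exchange_big_dep predT) //= [RHS](exchange_big_dep predT) //=.
apply: eq_bigr => i _.
rewrite [RHS](reindex_onto (fun S => i |: S) (fun S => S :\ i)) /=; last first.
  by move=> S /andP[_ iS]; rewrite setD1K.
apply: eq_bigl => S; rewrite !inE eqxx /= andbT.
case iS: (i \in S) => /=.
  rewrite andbF; apply/esym/negbTE/nandP; right.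
  by apply/eqP => /setP/(_ i); rewrite !inE eqxx iS.
by rewrite cardsU1 iS add1n eqSS setU1K ?iS // eqxx.
Qed.

Lemma cards_setC (S : {set I}) : #|~: S| = (N - #|S|)%N.
Proof. by rewrite cardsCs setCK. Qed.

Lemma card_subsets_succ k : (k <= N)%N ->
  (N - k)%:R * #|'Sub_k|%:R = k.+1%:R * #|'Sub_(k.+1)|%:R :> R.
Proof.
move=> kN; have := sum_subsets_succ (fun=> 1) k; rewrite sumr_const => <-.
rewrite (eq_bigr (fun=> (N - k)%:R)) => [|S]; first by rewrite sumr_const mulr_natr.
by rewrite inE => /eqP Sk; rewrite sumr_const cards_setC Sk.
Qed.

Variables (n : nat) (Y : I -> 'M[R]_n) (c : R).
Hypotheses (c_ge0 : 0 <= c) (Y_sym : forall i, (Y i)^T = Y i).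
Hypotheses (Y_bound : forall i, opbound (Y i) c) (Y_sum : \sum_i Y i = 0).

(* Normalised by [N - #|S|], the partial sums form a martingale when the sample
   grows by one uniformly chosen new element at a time. *)
Definition subset_mart (S : {set I}) : 'M[R]_n := (N - #|S|)%:R^-1 *: \sum_(i in S) Y i.

(** Written as the deviation of [Y i] from the mean of the undrawn elements, which makes centring
    and the norm bound visible. *)
Definition subset_incr (S : {set I}) (i : I) : 'M[R]_n :=
  (N - #|S|).-1%:R^-1 *: (Y i - (N - #|S|)%:R^-1 *: \sum_(j in ~: S) Y j).

Lemma sum_setC (S : {set I}) : \sum_(i in ~: S) Y i = - \sum_(i in S) Y i.
Proof.
have := Y_sum; rewrite (bigID (mem S)) /= addrC => /eqP; rewrite addr_eq0 => /eqP <-.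
by apply: eq_bigl => i; rewrite inE.
Qed.

Lemma subset_mart_sym S : (subset_mart S)^T = subset_mart S.
Proof.
by rewrite /subset_mart linearZ raddf_sum; congr (_ *: _); apply: eq_bigr => i _ /=.
Qed.

Lemma subset_incr_sym S i : (subset_incr S i)^T = subset_incr S i.
Proof.
rewrite /subset_incr linearZ linearB linearZ raddf_sum /= Y_sym.
by congr (_ *: (_ - _ *: _)); apply: eq_bigr => j _.
Qed.

(** Since the [Y i] sum to 0, the undrawn sum is minus the drawn one. The strict bound on [#|S|]
    keeps both denominators nonzero. *)
Lemma subset_martU1 (S : {set I}) i : (#|S|.+1 < N)%N -> i \in ~: S ->
  subset_mart (i |: S) = subset_mart S + subset_incr S i.
Proof.
move=> SN; rewrite inE => iS; rewrite /subset_mart /subset_incr sum_setC.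
rewrite big_setU1 //= cardsU1 iS add1n -subnS.
have k0 : (N - #|S|.+1)%:R != 0 :> R by rewrite pnatr_eq0 -lt0n subn_gt0.
have -> : (N - #|S|)%:R = (N - #|S|.+1)%:R + 1 :> R.
  by rewrite natr1 -subSn ?subSS // ltnW.
have k1 : (N - #|S|.+1)%:R + 1 != 0 :> R by rewrite natr1 pnatr_eq0.
move: (_%:R : R) k0 k1 => u u0 u1.
rewrite scalerN opprK !scalerDr scalerA addrCA -scalerDl; congr (_ + _ *: _).
by field; apply/andP.
Qed.

Lemma sum_subset_incr (S : {set I}) : (#|S| < N)%N -> \sum_(i in ~: S) subset_incr S i = 0.
Proof.
move=> SN; rewrite -scaler_sumr big_split /= sumr_const cards_setC.
rewrite -scaler_nat scalerN scalerA mulfV ?scale1r ?subrr ?scaler0 //.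
by rewrite pnatr_eq0 -lt0n subn_gt0.
Qed.

(** When a single element is left, increment and bound are both 0 because [0^-1 = 0]. *)
Lemma subset_incr_bound (S : {set I}) i : (#|S| < N)%N ->
  opbound (subset_incr S i) (4 * c / (N - #|S|).-1%:R ^+ 2).
Proof.
move=> SN; rewrite mulrC -exprVn; apply: opboundZ; apply: opboundB => //.
by rewrite -cards_setC; apply: opbound_mean => //; rewrite cards_setC subn_gt0.
Qed.

Definition mart_variance k : R := \sum_(j < k) 4 * c / (N - j).-1%:R ^+ 2.

(** Binomial theorem, or the coefficients of [exp (r s^2 / 2) exp (v s^2 / 2)]: variances of
    successive steps add. *)
Lemma expr_half_fact_sum (r v : R) p :
  \sum_(j < p.+1) (r / 2) ^+ j / j`!%:R * ((v / 2) ^+ (p - j) / (p - j)`!%:R) =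
  ((v + r) / 2) ^+ p / p`!%:R.
Proof.
rewrite mulrDl exprDn mulr_suml; apply: eq_bigr => -[j jp] _ /=.
rewrite ltnS in jp; rewrite -(bin_fact jp) !natrM -[_ *+ 'C(_, _)]mulr_natl.
have f0 k : k`!%:R != 0 :> R by rewrite pnatr_eq0 -lt0n fact_gt0.
have b0 : 'C(p, j)%:R != 0 :> R by rewrite pnatr_eq0 -lt0n bin_gt0.
move: (f0 j) (f0 (p - j)%N) b0.
move: (j`!%:R : R) ((p - j)`!%:R : R) ('C(p, j)%:R : R) => x y z x0 y0 z0.
move: ((r / 2) ^+ j) ((v / 2) ^+ (p - j)) => a b.
by field; rewrite x0 y0 z0.
Qed.

Lemma cosh_moment_mart_le p k : (k < N)%N ->
  \sum_(S in 'Sub_k) cosh_moment p (subset_mart S) <=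
  #|'Sub_k|%:R * (n%:R * ((mart_variance k / 2) ^+ p / p`!%:R)).
Proof.
elim: k p => [|k IH] p kN.
  have -> : #|'Sub_0| = 1%N.
    by rewrite -(cards1 (set0 : {set I})); apply: eq_card => S; rewrite !inE cards_eq0.
  rewrite (big_pred1 set0) => [|S]; last by rewrite !inE cards_eq0.
  rewrite /subset_mart big_set0 scaler0 /mart_variance big_ord0 mul0r mul1r.
  rewrite /cosh_moment; case: p => [|p].
    by rewrite double0 !expr0 !fact0 mxtrace1 !divr1 mulr1.
  by rewrite doubleS !expr0n /= mxtrace0 !mul0r mulr0.
have k1 : 0 < k.+1%:R :> R by rewrite ltr0n.
have E := card_subsets_succ (ltnW (ltnW kN)).
(* Times [k.+1], both sides run over pairs of a [k]-set and an element outside it, so the one-step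
   bound applies to each [S]. *)
rewrite -(ler_pM2l k1) -sum_subsets_succ (mulrA k.+1%:R) -E -(mulrA (N - k)%:R).
pose r : R := 4 * c / (N - k).-1%:R ^+ 2.
have r0 : 0 <= r by rewrite divr_ge0 ?exprn_ge0 // mulr_ge0.
apply: (@le_trans _ _ (\sum_(S in 'Sub_k) (N - k)%:R * \sum_(j < p.+1)
   (r / 2) ^+ j / j`!%:R * cosh_moment (p - j) (subset_mart S))).
  apply: ler_sum => S; rewrite inE => /eqP Sk.
  rewrite (eq_bigr (fun i => cosh_moment p (subset_mart S + subset_incr S i))); last first.
    by move=> i iS; rewrite subset_martU1 // Sk.
  have -> : (N - k)%N = #|~: S| by rewrite cards_setC Sk.
  apply: cosh_moment_step => //.
  - exact: subset_mart_sym.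
  - by move=> i _; apply: subset_incr_sym.
  - by move=> i _; rewrite /r -Sk; apply: subset_incr_bound; rewrite Sk ltnW.
  - by apply: sum_subset_incr; rewrite Sk ltnW.
rewrite -mulr_sumr ler_wpM2l //.
have -> : mart_variance k.+1 = mart_variance k + r by rewrite /mart_variance big_ord_recr.
rewrite exchange_big /= -expr_half_fact_sum !mulr_sumr; apply: ler_sum => j _.
rewrite -mulr_sumr.
have w0 : 0 <= (r / 2) ^+ j / j`!%:R.
  by apply: divr_ge0; [apply: exprn_ge0; apply: divr_ge0 | ].
apply: le_trans (ler_wpM2l w0 (IH _ (ltnW kN))) _.
by rewrite [leLHS]mulrCA [in leLHS](mulrCA _ n%:R).
Qed.

(** Telescoping: with [u = N - k - 1 >= 1], [1 / u^2 <= 2 (1 / u - 1 / (u + 1))]. *)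
Lemma mart_variance_le k : (k < N)%N ->
  mart_variance k <= 8 * c * ((N - k)%:R^-1 - N%:R^-1).
Proof.
elim: k => [|k IH] kN; first by rewrite /mart_variance big_ord0 subn0 subrr mulr0.
rewrite /mart_variance big_ord_recr /= -/(mart_variance k).
apply: le_trans (lerD (IH (ltnW kN)) (lexx _)) _.
have u1 : 1 <= (N - k.+1)%:R :> R by rewrite ler1n subn_gt0.
have -> : (N - k)%:R = (N - k.+1)%:R + 1 :> R by rewrite natr1 -subSn ?subSS // ltnW.
rewrite -subnS; move: (_%:R : R) u1 => u u1.
have u0 : u != 0 by lra.
have u2 : u + 1 != 0 by lra.
have [u3 u4] : 0 < u /\ 0 < u + 1 by lra.
rewrite -subr_ge0.
have -> : 8 * c * (u^-1 - N%:R^-1) - (8 * c * ((u + 1)^-1 - N%:R^-1) + 4 * c / u ^+ 2) =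
          4 * c * ((u - 1) / (u ^+ 2 * (u + 1))).
  set w := N%:R^-1; field; exact/andP.
apply: mulr_ge0; first exact: mulr_ge0.
apply: divr_ge0; first by rewrite subr_ge0.
by apply: mulr_ge0; [exact: sqr_ge0 | exact: ltW].
Qed.

Lemma scalemxX a (A : 'M[R]_n) k : (a *: A) ^+ k = a ^+ k *: A ^+ k.
Proof.
elim: k => [|k IH]; first by rewrite !expr0 scale1r.
by rewrite !exprS IH -!mulmxE -scalemxAl -scalemxAr scalerA.
Qed.

Lemma cosh_momentZ p a (A : 'M[R]_n) :
  cosh_moment p (a *: A) = (a ^+ 2) ^+ p * cosh_moment p A.
Proof. by rewrite /cosh_moment scalemxX linearZ /= -exprM mul2n mulrA. Qed.

Lemma cosh_moment_sample_mean_le p k : (0 < k < N)%N ->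
  \sum_(S in 'Sub_k) cosh_moment p (k%:R^-1 *: \sum_(i in S) Y i) <=
  #|'Sub_k|%:R * (n%:R * ((8 * c * (k%:R^-1 - N%:R^-1) / 2) ^+ p / p`!%:R)).
Proof.
case/andP => k0 kN.
have kp : 0 < k%:R :> R by rewrite ltr0n.
have Np : 0 < N%:R :> R by rewrite ltr0n (ltn_trans k0).
have Nkp : 0 < (N - k)%:R :> R by rewrite ltr0n subn_gt0.
(* The sample mean is [a] times the martingale, and [a^2 (1 / (N - k) - 1 / N) = 1 / k - 1 / N]. *)
pose a : R := (N - k)%:R / k%:R.
rewrite (eq_bigr (fun S => (a ^+ 2) ^+ p * cosh_moment p (subset_mart S))); last first.
  move=> S; rewrite inE => /eqP Sk; rewrite -cosh_momentZ /subset_mart Sk scalerA.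
  by rewrite /a mulrAC mulfV ?mul1r // gt_eqF.
rewrite -mulr_sumr.
have a0 : 0 <= (a ^+ 2) ^+ p by rewrite exprn_ge0 // sqr_ge0.
apply: le_trans (ler_wpM2l a0 (cosh_moment_mart_le p kN)) _.
rewrite mulrCA ler_wpM2l // mulrCA ler_wpM2l // mulrA ler_wpM2r ?invr_ge0 //.
rewrite -exprMn; apply: lerXn2r.
- rewrite nnegrE mulr_ge0 ?sqr_ge0 // divr_ge0 //; apply: sumr_ge0 => j _.
  by rewrite divr_ge0 ?exprn_ge0 // mulr_ge0.
- rewrite nnegrE divr_ge0 // mulr_ge0 ?mulr_ge0 // subr_ge0.
  by rewrite lef_pV2 ?posrE // ler_nat ltnW.
rewrite mulrA ler_wpM2r ?invr_ge0 //.
apply: le_trans (ler_wpM2l (sqr_ge0 _) (mart_variance_le kN)) _.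
rewrite le_eqVlt; apply/orP; left; apply/eqP.
rewrite /a natrB ?(ltnW kN) //.
have h1 : k%:R != 0 :> R by rewrite gt_eqF.
have h2 : N%:R != 0 :> R by rewrite gt_eqF.
have h3 : N%:R - k%:R != 0 :> R by rewrite -natrB ?(ltnW kN) // gt_eqF.
by move: (k%:R : R) (N%:R : R) h1 h2 h3 => x y h1 h2 h3; field; rewrite h1 h2 h3.
Qed.

End Sampling.

(** * Tail bounds for the sample mean *)

Lemma sampling_deviation_moment (R : rcfType) (I : finType) m n
    (X : I -> 'M[R]_(m, n)) (c t : R) (k p : nat) (B : {set {set I}}) :
  (0 < m)%N -> (0 < k < #|I|)%N -> 0 <= c -> 0 <= t -> (forall i, opbound (X i) c) ->
  (forall S, S \in B -> #|S| = k /\ exists2 v : 'rV[R]_m, frob v <= 1 &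
     t <= frob (v *m (k%:R^-1 *: \sum_(i in S) X i - #|I|%:R^-1 *: \sum_i X i))) ->
  #|B|%:R * (t ^+ p / (p.*2)`!%:R) <=
  #|[set S : {set I} | #|S| == k]|%:R *
    ((m + n)%:R * ((32 * c * (k%:R^-1 - #|I|%:R^-1) / 2) ^+ p / p`!%:R)).
Proof.
move=> m0 kN c0 t0 hX hB.
have [k0 kN'] := andP kN.
have I0 : (0 < #|I|)%N by exact: ltn_trans kN'.
pose mu := #|I|%:R^-1 *: \sum_i X i.
pose Y i := dilation (X i - mu).
have Ysym i : (Y i)^T = Y i by exact: dilation_sym.
have Ybound i : opbound (Y i) (4 * c).
  apply: opbound_dilation; first by rewrite mulr_ge0.
  by apply: opboundB => //; rewrite /mu; apply: opbound_mean.
have Ysum : \sum_i Y i = 0.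
  rewrite -dilation_sum big_split /= sumr_const -scaler_nat scalerN scalerA mulfV.
    by rewrite scale1r subrr dilation0.
  by rewrite pnatr_eq0 -lt0n.
have c4 : 0 <= 4 * c by rewrite mulr_ge0.
have := cosh_moment_sample_mean_le c4 Ysym Ybound Ysum p kN.
(* Here 8 comes from the variance sum and 4 from centring the [X i]. *)
rewrite [8 * _]mulrA (_ : 8 * 4 = 32) => [|]; last by rewrite -natrM.
apply: le_trans.
(* Markov's inequality: samples outside [B] contribute nonnegatively, and each one in [B] at least
   [t ^+ p / (p.*2)!]. *)
apply: (@le_trans _ _ (\sum_(S in B) cosh_moment p (k%:R^-1 *: \sum_(i in S) Y i))); last first.
  rewrite [leRHS](bigID (mem B)) /= [X in _ <= X + _](eq_bigl (mem B)); last first.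
    move=> S; rewrite !inE; case: (boolP (S \in B)) => SB; rewrite ?andbF ?andbT //.
    by have [-> _] := hB _ SB; rewrite eqxx.
  rewrite lerDl; apply: sumr_ge0 => S _; apply: cosh_moment_ge0.
  rewrite linearZ raddf_sum; congr (_ *: _).
  by apply: eq_bigr => i _; apply: Ysym.
rewrite mulr_natl -sumr_const; apply: ler_sum => S SB.
have [Sk [v v1 hv]] := hB _ SB.
set D := k%:R^-1 *: \sum_(i in S) X i - mu in hv *.
have -> : k%:R^-1 *: \sum_(i in S) Y i = dilation D.
  rewrite -dilation_sum -dilationZ big_split /= sumr_const Sk -scaler_nat scalerDr.
  by rewrite scalerA mulVf ?scale1r // pnatr_eq0 -lt0n.
rewrite ler_wpM2r ?invr_ge0 //.
(* The moment of order 0 is the dimension [m + n], at least 1 since [m > 0]. *)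
case: p => [|p].
  by rewrite double0 !expr0 mxtrace1 ler1n addn_gt0 m0.
apply: le_trans (frob_mulmx_expr_le (v := row_mx v 0) p (dilation_sym D) _).
  by rewrite frob_mul_dilation lerXn2r ?nnegrE ?frob_ge0.
by rewrite frob_row_mx frob0 addr0.
Qed.

Local Notation R := Rdefinitions.R.

Lemma E1_sum (x : R) n : E1 x n = \sum_(k < n.+1) x ^+ k / k`!%:R.
Proof.
rewrite /E1 sum_f_R0E big_mkord; apply: eq_bigr => k _.
by rewrite RmultE RinvE INRE factE RpowE mulrC.
Qed.

Lemma exp_partial_sum_le (u : R) n : 0 <= u -> \sum_(k < n.+1) u ^+ k / k`!%:R <= exp u.
Proof.
move=> u0; apply/RleP; rewrite -E1_sum.
apply: (growing_ineq (E1 u) (exp u)); last exact: E1_cvg.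
move=> k; apply/RleP; rewrite !E1_sum [leRHS]big_ord_recr /= lerDl.
by rewrite divr_ge0 ?exprn_ge0.
Qed.

Lemma E1_even_sum (x : R) n :
  E1 x n.*2 + E1 (- x) n.*2 = 2 * \sum_(k < n.+1) x ^+ k.*2 / (k.*2)`!%:R.
Proof.
rewrite !E1_sum; elim: n => [|n IH].
  by rewrite double0 !big_ord1 !expr0 fact0 divr1 mulr2n mulr1.
rewrite doubleS big_ord_recr big_ord_recr /= [X in _ + X]big_ord_recr /=.
rewrite [X in _ + (X + _)]big_ord_recr /= [in RHS]big_ord_recr /= mulrDr -IH.
have -> : (- x) ^+ n.*2.+1 = - x ^+ n.*2.+1.
  by rewrite exprNn -signr_odd /= odd_double expr1 mulN1r.
have -> : (- x) ^+ n.*2.+2 = x ^+ n.*2.+2.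
  by rewrite exprNn -signr_odd /= odd_double expr0 mul1r.
rewrite doubleS mulNr.
by move: (_ / _) (_ / _) (\sum_(_ < _) _) (\sum_(_ < _) _) => *; ring.
Qed.

(** The even partial sums tend to [(exp x + exp (- x)) / 2]; the slack [exp (- x) / 2] lets a finite
    one already reach [exp x / 2]. So finitely many moments suffice. *)
Lemma exp_half_le_even_sum (x : R) :
  exists n, exp x / 2 <= \sum_(k < n.+1) x ^+ k.*2 / (k.*2)`!%:R.
Proof.
have cv := CV_plus _ _ _ _ (E1_cvg x) (E1_cvg (Ropp x)).
have [n hn] := cv (exp (Ropp x)) (exp_pos _).
exists n; have : (n <= n.*2)%coq_nat by apply/ssrnat.leP; rewrite -addnn leq_addr.
move/hn; rewrite /Rdist => /Rabs_def2 [_ /RltP].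
rewrite !RplusE !RminusE !RoppE E1_even_sum => h.
rewrite ler_pdivrMr // mulrC; move: h; lra.
Qed.

(* Multiplying the [p]-th moment by [(t / W ^ 2) ^ p] and summing over [p] is the
   Chernoff bound for [cosh] at the optimal parameter. *)
Lemma sampling_tail (I : finType) m n (X : I -> 'M[R]_(m, n)) (c t zeta l : R) (k : nat)
    (B : {set {set I}}) :
  (0 < m)%N -> (0 < k < #|I|)%N -> 0 < c -> 0 <= t -> 0 < zeta ->
  (forall i, opbound (X i) c) ->
  2 * (m + n)%:R <= zeta * exp l -> l <= t / (64 * c * (k%:R^-1 - #|I|%:R^-1)) ->
  (forall S, S \in B -> #|S| = k /\ exists2 v : 'rV[R]_m, frob v <= 1 &
     t <= frob (v *m (k%:R^-1 *: \sum_(i in S) X i - #|I|%:R^-1 *: \sum_i X i))) ->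
  #|B|%:R <= zeta * #|[set S : {set I} | #|S| == k]|%:R.
Proof.
move=> m0 kN c0 t0 z0 hX hzeta hl hB.
have [k0 kN'] := andP kN.
pose W := 32 * c * (k%:R^-1 - #|I|%:R^-1).
have W0 : 0 < W.
  rewrite /W pmulr_rgt0 ?subr_gt0 ?ltf_pV2 ?posrE ?ltr0n ?ltr_nat ?mulr_gt0 //.
  exact: ltn_trans kN'.
(* [t] is a squared threshold and [W] the variance, so [u] is the Gaussian exponent. At
   [s^2 = t / W^2] one has [s^2 t = (2 u)^2] and [s^2 W / 2 = u]. *)
pose u := t / (2 * W).
have {}hl : l <= u.
  by rewrite /u /W !mulrA (_ : 2 * 32 = 64) // -natrM.
have u0 : 0 <= u by rewrite divr_ge0 // mulr_ge0 // ltW.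
set T : R := #|[set S : {set I} | _]|%:R; pose D : R := (m + n)%:R.
have D0 : 0 < D by rewrite ltr0n addn_gt0 m0.
have T0 : 0 <= T by [].
have [P hP] := exp_half_le_even_sum (2 * u).
have key : #|B|%:R * \sum_(p < P.+1) (2 * u) ^+ p.*2 / (p.*2)`!%:R <=
           T * D * \sum_(p < P.+1) u ^+ p / p`!%:R.
  rewrite !mulr_sumr; apply: ler_sum => p _.
  have l0 : 0 <= (t / W ^+ 2) ^+ p by rewrite exprn_ge0 // divr_ge0 // exprn_ge0 // ltW.
  have := ler_wpM2l l0 (sampling_deviation_moment p m0 kN (ltW c0) t0 hX hB).
  rewrite -/T -/D -/W.
  have -> : (2 * u) ^+ p.*2 = (t / W ^+ 2) ^+ p * t ^+ p.
    rewrite -mul2n exprM -exprMn; congr (_ ^+ _); rewrite /u; field; exact: lt0r_neq0.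
  have -> : u ^+ p = (t / W ^+ 2) ^+ p * (W / 2) ^+ p.
    rewrite -exprMn; congr (_ ^+ _); rewrite /u; field; exact: lt0r_neq0.
  move: ((t / W ^+ 2) ^+ p) (t ^+ p) ((W / 2) ^+ p) => a b e.
  move: ((p.*2)`!%:R^-1 : R) (p`!%:R^-1 : R) => f g h.
  have -> : #|B|%:R * (a * b * f) = a * (#|B|%:R * (b * f)) by ring.
  apply: le_trans h _; rewrite le_eqVlt; apply/orP; left; apply/eqP; ring.
pose u2 := 2 * u; rewrite -/u2 in hP key.
(* The cosh side reaches [exp (2 u) / 2] while the Gaussian side stays below [exp u]; dividing
   leaves the tail [2 D exp (- u)]. *)
have {}key : #|B|%:R * (exp u2 / 2) <= T * D * exp u.
  apply: (le_trans (ler_wpM2l (ler0n _ _) hP)); apply: le_trans key _.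
  by apply: ler_wpM2l; [rewrite mulr_ge0 // ltW | exact: exp_partial_sum_le].
have E0 : 0 < exp u by apply/RltP; exact: exp_pos.
have E2 : exp u2 = exp u * exp u by rewrite expRD /u2 mulr_natl mulr2n.
have hD : 2 * D <= zeta * exp u.
  apply: le_trans hzeta _; rewrite ler_wpM2l ?(ltW z0) //.
  by move: hl; rewrite le_eqVlt => /predU1P[->|/RltP/exp_increasing/RltP/ltW].
have h1 : #|B|%:R * exp u <= T * (2 * D).
  rewrite -(ler_pM2r E0); move: key; rewrite E2; move: (exp u) => e; nra.
have h2 : #|B|%:R * (2 * D) <= zeta * T * (2 * D).
  have b0 : 0 <= #|B|%:R :> R by [].
  have := ler_wpM2l b0 hD; have := ler_wpM2r (ltW z0) h1.
  move: (#|B|%:R : R) (exp u) => b e; nra.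
by rewrite -(@ler_pM2r _ (2 * D)) // mulr_gt0.
Qed.

(** Common form for gradients and Hessians: [dev] only has to supply a test vector when it exceeds
    [T]. Inverting the sample-size condition gives [1 / k - 1 / N <= T^2 / (64 c l)], and the good
    samples are counted as the complement of the bad ones. *)
Lemma sampling_concentration (N m n k : nat) (X : 'I_N -> 'M[R]_(m, n))
    (c T zeta l : R) (dev : {set 'I_N} -> R) :
  (0 < m)%N -> (k < N)%N -> 0 <= c -> 0 < T -> 0 < zeta -> 0 < l ->
  (forall i, opbound (X i) c) -> 2 * (m + n)%:R <= zeta * exp l ->
  (N%:R^-1 + T ^+ 2 / (64 * c * l))^-1 <= k%:R ->
  (forall S : {set 'I_N}, #|S| = k -> T < dev S -> exists2 v : 'rV[R]_m, frob v <= 1 &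
     T ^+ 2 <= frob (v *m (k%:R^-1 *: \sum_(i in S) X i - N%:R^-1 *: \sum_i X i))) ->
  (1 - zeta) * #|[set S : {set 'I_N} | #|S| == k]|%:R <=
  #|[set S : {set 'I_N} | (#|S| == k) && Rleb (dev S) T]|%:R.
Proof.
move=> m0 kN c0 T0 z0 l0 hX hz hk hdev.
have N0 : 0 < N%:R :> R by rewrite ltr0n (leq_ltn_trans _ kN).
have {}c0 : 0 < c.
  (* For c = 0 the quotient in hk is 0, so hk would force N <= k. *)
  rewrite lt_neqAle c0 andbT; apply/eqP => cE; move: hk.
  by rewrite -cE mulr0 mul0r invr0 mulr0 addr0 invrK ler_nat leqNgt kN.
pose q := T ^+ 2 / (64 * c * l).
have q0 : 0 < q by rewrite divr_gt0 ?exprn_gt0 // !mulr_gt0.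
have s0 : 0 < N%:R^-1 + q by rewrite addr_gt0 ?invr_gt0.
have k0 : 0 < k%:R :> R by apply: lt_le_trans hk; rewrite invr_gt0.
have hkq : k%:R^-1 - N%:R^-1 <= q.
  by rewrite lerBlDl -[leRHS]invrK lef_pV2 ?posrE ?invr_gt0.
have w0 : 0 < k%:R^-1 - N%:R^-1 :> R by rewrite subr_gt0 ltf_pV2 ?posrE // ltr_nat.
pose B := [set S : {set 'I_N} | (#|S| == k) && ~~ Rleb (dev S) T].
set A := [set S : {set 'I_N} | (#|S| == k) && _].
set Sk := [set S : {set 'I_N} | #|S| == k].
have AB : #|Sk| = (#|A| + #|B|)%N.
  rewrite -(cardsID A Sk); congr (_ + _)%N; apply: eq_card => S; rewrite !inE.
    by case: (#|S| == k).
  by case: (#|S| == k); case: Rleb.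
suff : #|B|%:R <= zeta * #|Sk|%:R :> R.
  by rewrite {2}AB natrD AB natrD; move: (_%:R : R) (_%:R : R) => a b; lra.
have := @sampling_tail _ m n X c (T ^+ 2) zeta l k B m0.
rewrite card_ord -/Sk; apply=> //.
- by rewrite -(ltr0n R) k0.
- exact: sqr_ge0.
- rewrite ler_pdivlMr; last by rewrite !mulr_gt0.
  have := ler_wpM2l (ltW (mulr_gt0 (mulr_gt0 (ltr0Sn R 63) c0) l0)) hkq.
  rewrite /q mulrCA mulfV ?mulr1; last by rewrite gt_eqF // !mulr_gt0.
  by move=> h; rewrite mulrC mulrAC.
- move=> S; rewrite inE => /andP[/eqP Sc nS]; split=> //; apply: hdev => //.
  move: nS; rewrite /Rleb; case: (Rle_dec (dev S) T) => // h _.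
  by apply/RltP; apply: Rnot_le_lt.
Qed.

(** * Vectors, operator norms and estimators as matrices *)

Definition rowv d (v : vec d) : 'rV[R]_d := \row_j v j.
(* Transposed, since MathComp's matrices act on row vectors. *)
Definition tmat d (A : mat d) : 'M[R]_d := \matrix_(b, a) A a b.

Lemma vnorm_ge0 d (v : vec d) : 0 <= vnorm v.
Proof. by rewrite /vnorm RsqrtE ?sqrtr_ge0. Qed.

Lemma vnorm_sqr d (v : vec d) : vnorm v ^+ 2 = frob (rowv v).
Proof.
rewrite /vnorm RsqrtE sqr_sqrtr; last by apply: sumr_ge0 => j _; apply: sqr_ge0.
by rewrite frobE big_ord1; apply: eq_bigr => j _; rewrite mxE expr2.
Qed.

Lemma rowv_matvec d (A : mat d) (v : vec d) : rowv (matvec A v) = rowv v *m tmat A.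
Proof.
by apply/rowP => i; rewrite !mxE; apply: eq_bigr => j _; rewrite !mxE [RHS]mulrC.
Qed.

(** The value is chosen by [epsilon], so the supremum must be shown to exist. *)
Lemma opnorm_lub d (A : mat d) :
  is_lub (fun r => exists v : vec d, Rle (vnorm v) 1 /\ r = vnorm (matvec A v)) (opnorm A).
Proof.
apply: epsilon_spec.
have [] // := completeness (fun r => exists v : vec d, Rle (vnorm v) 1 /\ r = vnorm (matvec A v)).
(* From [x^2 <= y] follows [x <= 1 + y], a bound without square roots. *)
- exists (1 + frob (tmat A)) => _ [v [/RleP v1 ->]]; apply/RleP.
  have v2 : frob (rowv v) <= 1 by rewrite -vnorm_sqr expr_le1 ?vnorm_ge0.
  have h : vnorm (matvec A v) ^+ 2 <= frob (tmat A).
    rewrite vnorm_sqr rowv_matvec; apply: le_trans (frob_mulmx_le _ _) _.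
    by rewrite ler_piMl ?frob_ge0.
  have := vnorm_ge0 (matvec A v); have := frob_ge0 (tmat A); move: h.
  move: (vnorm _) (frob _) => x y; nra.
- exists (vnorm (matvec A (fun=> 0))), (fun=> 0); split => //; apply/RleP.
  by rewrite /vnorm big1 ?sqrt_0 // => j _; rewrite RmultE mulr0.
- by move=> c hc; exists c.
Qed.

(** A number below the supremum is not an upper bound; this yields the test vector for
    [sampling_concentration]. *)
Lemma opnorm_gt d (A : mat d) (T : R) : T < opnorm A ->
  exists2 v : vec d, vnorm v <= 1 & T < vnorm (matvec A v).
Proof.
move=> hT; apply: NNPP => hn.
have [_ /(_ T) lub] := opnorm_lub A.
suff /lub /RleP : is_upper_bound
    (fun r => exists v : vec d, Rle (vnorm v) 1 /\ r = vnorm (matvec A v)) T.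
  by rewrite leNgt hT.
move=> _ [v [/RleP v1 ->]]; apply/RleP; rewrite leNgt; apply/negP => h.
by apply: hn; exists v.
Qed.

Lemma opnorm_opbound d (A : mat d) (c : R) : opnorm A <= c -> opbound (tmat A) (c ^+ 2).
Proof.
move=> hA v.
have [v0|vn0] := eqVneq (frob v) 0.
  by rewrite v0 (frob_eq0 v0) mul0mx frob0 mulr0.
have vp : 0 < frob v by rewrite lt_neqAle eq_sym vn0 frob_ge0.
have s0 : 0 < Num.sqrt (frob v) by rewrite sqrtr_gt0.
pose w : vec d := fun j => (Num.sqrt (frob v))^-1 * v 0 j.
have wE : rowv w = (Num.sqrt (frob v))^-1 *: v by apply/rowP => j; rewrite !mxE.
have fw a b (M : 'M[R]_(a, b)) :
    frob M = frob v * frob ((Num.sqrt (frob v))^-1 *: M).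
  by rewrite frobZ exprVn sqr_sqrtr ?(ltW vp) // mulrA mulfV ?mul1r.
have w1 : vnorm w <= 1.
  rewrite -(@ler_sqr _ _ 1) ?nnegrE ?vnorm_ge0 // expr1n vnorm_sqr wE.
  by rewrite -(ler_pM2l vp) -fw mulr1.
have : vnorm (matvec A w) <= c.
  apply: le_trans hA; apply/RleP; have [ub _] := opnorm_lub A.
  by apply: ub; exists w; split => //; apply/RleP.
have := vnorm_ge0 (matvec A w) => g0 h.
have : vnorm (matvec A w) ^+ 2 <= c ^+ 2.
  by rewrite ler_sqr ?nnegrE // (le_trans g0).
rewrite vnorm_sqr rowv_matvec wE -scalemxAl => h2.
by rewrite (fw _ _ (v *m tmat A)) mulrC ler_pM2r.
Qed.

Lemma opbound_rowv d (v : vec d) (c : R) : vnorm v <= c -> opbound (rowv v) (c ^+ 2).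
Proof.
move=> hv u; apply: le_trans (frob_mulmx_le _ _) _; rewrite mulrC.
apply: ler_wpM2r; first exact: frob_ge0.
by rewrite -vnorm_sqr ler_sqr ?nnegrE ?vnorm_ge0 // (le_trans (vnorm_ge0 v)).
Qed.

Lemma Rmax_sqr (a b : R) : 0 <= a -> 0 <= b -> Rmax a b ^+ 2 = Rmax (a ^+ 2) (b ^+ 2).
Proof.
move=> a0 b0; rewrite !RmaxE; case: (leP a b) => h.
  by rewrite max_r // ler_sqr.
by rewrite max_l // ler_sqr // ltW.
Qed.

(** The reference gradient at [xt] minus the full gradient at [xk] is minus the population mean of
    the differences, so the estimator error is a pure sampling error. *)
Lemma rowv_g_est d N (G : 'I_N -> vec d -> vec d) (S : {set 'I_N}) xk xt :
  rowv (vsub (g_est G S xk xt) (gradF G xk)) =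
  #|S|%:R^-1 *: \sum_(i in S) rowv (vsub (G i xk) (G i xt)) -
  N%:R^-1 *: \sum_i rowv (vsub (G i xk) (G i xt)).
Proof.
apply/rowP => j; rewrite !mxE !summxE /vsub /g_est /gradF.
rewrite !RminusE !RplusE !RmultE !RinvE !INRE.
have E (P : pred 'I_N) : \sum_(i | P i) rowv (vsub (G i xk) (G i xt)) 0 j = \sum_(i | P i) (G i xk j - G i xt j).
  by apply: eq_bigr => i _; rewrite mxE.
rewrite !E.
rewrite -addrA; congr (_ + _).
by rewrite sumrB mulrBr opprB.
Qed.

Lemma tmat_H_est d N (H : 'I_N -> vec d -> mat d) (S : {set 'I_N}) xk xt :
  tmat (msub (H_est H S xk xt) (hessF H xk)) =
  #|S|%:R^-1 *: \sum_(i in S) tmat (msub (H i xk) (H i xt)) -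
  N%:R^-1 *: \sum_i tmat (msub (H i xk) (H i xt)).
Proof.
apply/matrixP => b a; rewrite !mxE !summxE /msub /H_est /hessF.
rewrite !RminusE !RplusE !RmultE !RinvE !INRE.
have E (P : pred 'I_N) : \sum_(i | P i) tmat (msub (H i xk) (H i xt)) b a = \sum_(i | P i) (H i xk a b - H i xt a b).
  by apply: eq_bigr => i _; rewrite mxE.
rewrite !E.
rewrite -addrA; congr (_ + _).
by rewrite sumrB mulrBr opprB.
Qed.

(** Applied with [a] twice the dilated dimension, so that the tail [a exp (- l)] is at most
    [zeta]. *)
Lemma ln_ratio (a zeta : R) : 1 <= a -> 0 < zeta < 1 ->
  0 < ln (a / zeta) /\ a <= zeta * exp (ln (a / zeta)).
Proof.
move=> a1 /andP[z0 z1]; have q1 : 1 < a / zeta.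
  by rewrite ltr_pdivlMr // mul1r (lt_le_trans z1).
have q0 : 0 < a / zeta by exact: lt_trans q1.
split; last by rewrite exp_ln; [rewrite mulrCA mulfV ?mulr1 // gt_eqF | exact/RltP].
apply/RltP; have -> : 0 = ln 1 :> R by rewrite ln_1.
by apply: ln_increasing; [exact: Rlt_0_1 | exact/RltP].
Qed.

Local Close Scope ring_scope.
Local Open Scope R_scope.

Theorem theorem5 (d N : nat)
  (f : 'I_N -> vec d -> R) (G : 'I_N -> vec d -> vec d) (H : 'I_N -> vec d -> mat d)
  (L0 L1 L2 alpha beta eps1 zeta : R) (xk xt sk : vec d) (bg bH : nat) :
  (1 <= d)%nat -> (1 <= N)%nat ->
  (exists lb : R, forall x, lb <= Favg f x) ->
  (forall i x, has_gradient (f i) (G i x) x) ->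
  (forall i x, has_jacobian (G i) (H i x) x) ->
  (forall i x y, Rabs (f i x - f i y) <= L0 * vnorm (vsub x y)) ->
  (forall i x y, vnorm (vsub (G i x) (G i y)) <= L1 * vnorm (vsub x y)) ->
  (forall i x y, opnorm (msub (H i x) (H i y)) <= L2 * vnorm (vsub x y)) ->
  0 < alpha -> 0 < beta -> 0 < eps1 -> 0 < zeta < 1 ->
  (bg < N)%nat -> (bH < N)%nat ->
  ((INR bg >= / (/ INR N + beta ^ 2 * Rmax (vnorm sk ^ 4) (eps1 ^ 4)
        / (64 * L1 ^ 2 * vnorm (vsub xk xt) ^ 2 * ln (2 * (INR d + 1) / zeta)))) ->
    INR #|[set S : {set 'I_N} | (#|S| == bg)%nat &&
            Rleb (vnorm (vsub (g_est G S xk xt) (gradF G xk)))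
                 (beta * Rmax (vnorm sk ^ 2) (eps1 ^ 2))]|
    >= (1 - zeta) * INR #|[set S : {set 'I_N} | (#|S| == bg)%nat]|)
  /\
  ((INR bH >= / (/ INR N + alpha ^ 2 * Rmax (vnorm sk ^ 2) (eps1 ^ 2)
        / (64 * L2 ^ 2 * vnorm (vsub xk xt) ^ 2 * ln (4 * INR d / zeta)))) ->
    INR #|[set S : {set 'I_N} | (#|S| == bH)%nat &&
            Rleb (opnorm (msub (H_est H S xk xt) (hessF H xk)))
                 (alpha * Rmax (vnorm sk) eps1)]|
    >= (1 - zeta) * INR #|[set S : {set 'I_N} | (#|S| == bH)%nat]|).
Proof.
move=> d1 N1 _ _ _ _ hG hH a0 b0 e0 zeta01 bgN bHN.
have z01 : (0 < zeta < 1)%R by apply/andP; split; apply/RltP; case: zeta01.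
have z0 : (0 < zeta)%R by case/andP: z01.
have e1 : (0 <= eps1)%R by apply/ltW/RltP.
have e64 : (IZR 64 = 64%:R :> R)%R by rewrite IZRposE INRE.
have e4 : (IZR 4 = 4%:R :> R)%R by rewrite IZRposE INRE.
have dge1 : (1 <= d%:R :> R)%R by rewrite ler1n.
split=> /Rge_le/RleP hk; apply: Rle_ge; apply/RleP; rewrite !INRE.
(* Gradients are [1] by [d] matrices, so the dilated dimension is [d + 1]; the Lipschitz bound gives
   [c = (L1 |xk - xt|)^2]. *)
- have T0 : (0 < beta * Rmax (vnorm sk ^ 2) (eps1 ^ 2))%R.
    apply/RltP; apply: Rmult_lt_0_compat => //.
    apply: Rlt_le_trans (Rmax_r _ _); exact: pow_lt.
  have [|l0 hl] := @ln_ratio (2 * (INR d + 1))%R zeta _ z01.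
    rewrite INRE; lra.
  apply: (sampling_concentration (m := 1) (n := d) (l := ln (2 * (INR d + 1) / zeta))
    (X := fun i => rowv (vsub (G i xk) (G i xt))) (c := ((L1 * vnorm (vsub xk xt)) ^+ 2)%R)
    (dev := fun S => vnorm (vsub (g_est G S xk xt) (gradF G xk)))) => //.
  + exact: sqr_ge0.
  + by move=> i; apply: opbound_rowv; apply/RleP.
  + by apply: le_trans hl; rewrite INRE natrD addrC.
  + move: hk; rewrite INRE e64 !RpowE !RmultE !RplusE RdivE !RinvE !INRE.
    rewrite !exprMn Rmax_sqr ?exprn_ge0 ?vnorm_ge0 // -!exprM !mulrA; exact.
  (* A matrix with one row is tested by the scalar 1. *)
  + move=> S Sk h; exists 1%R; first by rewrite /frob trmx1 mulmx1 mxtrace1.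
    rewrite mul1mx -Sk -rowv_g_est -vnorm_sqr ler_sqr ?nnegrE ?vnorm_ge0 ?(ltW T0) //.
    exact: ltW.
(* Hessians are [d] by [d], so the dilated dimension is [2 d], whence [4 d] in the logarithm. *)
- have T0 : (0 < alpha * Rmax (vnorm sk) eps1)%R.
    apply/RltP; apply: Rmult_lt_0_compat => //.
    apply: Rlt_le_trans (Rmax_r _ _); exact: e0.
  have [|l0 hl] := @ln_ratio (4 * INR d) zeta _ z01.
    rewrite RmultE e4 INRE; lra.
  apply: (sampling_concentration (m := d) (n := d) (l := ln (4 * INR d / zeta))
    (X := fun i => tmat (msub (H i xk) (H i xt))) (c := ((L2 * vnorm (vsub xk xt)) ^+ 2)%R)
    (dev := fun S => opnorm (msub (H_est H S xk xt) (hessF H xk)))) => //.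
  + exact: sqr_ge0.
  + by move=> i; apply: opnorm_opbound; apply/RleP.
  + apply: le_trans hl; rewrite RmultE e4 INRE natrD; lra.
  + move: hk; rewrite INRE e64 !RpowE !RmultE !RplusE RdivE !RinvE !INRE.
    rewrite !exprMn Rmax_sqr ?vnorm_ge0 // !mulrA; exact.
  + move=> S Sk /opnorm_gt [v v1 h]; exists (rowv v).
      by rewrite -vnorm_sqr expr_le1 ?vnorm_ge0.
    rewrite -Sk -tmat_H_est -rowv_matvec -vnorm_sqr ler_sqr ?nnegrE ?vnorm_ge0 ?(ltW T0) //.
    exact: ltW.
Qed.
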